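(* Let $G$ be a finite connected undirected weighted graph with at least two vertices. Let $MDT(x)$ denote the mean diffusion time and $IC(x)$ the information centrality of a vertex $x$. Then $$\operatorname*{arg\,min}_{x\in G}MDT(x)=\operatorname*{arg\,max}_{x\in G}IC(x),$$ i.e. the set of vertices minimizing $MDT$ equals the set of vertices maximizing $IC$.
   Context: $G$ is a finite undirected graph with vertex set $V$ (one writes $x\in G$ for $x\in V$), $N$ vertices, and symmetric edge weights $w_{x,y}=w_{y,x}\ge 0$; write $x\sim y$ if $x\neq y$ and $w_{x,y}>0$. The graph Laplacian $\Delta$ acts on functions $f:V\to\mathbb{R}$ by $\Delta f(x)=\sum_{z\sim x}w_{x,z}(f(x)-f(z))$. It is symmetric and nonnegative on $L^2(G)=\mathbb{R}^V$ with inner product $\langle u,v\rangle=\sum_{x}u(x)v(x)$ and norm $\|u\|^2=\langle u,u\rangle$. Its eigenvalues, listed with multiplicity, are $0=\lambda_0<\lambda_1\le\cdots\le\lambda_{N-1}$ (with $\lambda_1>0$ since $G$ is connected), with a corresponding orthonormal basis of real eigenvectors $\phi_0,\dots,\phi_{N-1}$, where $\phi_0=1/\sqrt N$. The Hermitian graph wavelet at scale $t>0$ centered at $x$ is $$\psi_{t,x}(y)=\sum_{k=1}^{N-1}t\lambda_k e^{-t\lambda_k}\phi_k(x)\phi_k(y).$$ The mean diffusion time of a vertex $x$ is $$MDT(x)=\int_0^\infty\|\psi_{t,x}\|^2\,dt.$$ The information centrality of a vertex $x$ is given by $$IC(x)=\left(\sum_{k=1}^{N-1}\frac{|\phi_k(x)|^2}{\lambda_k}+\frac1N\sum_{z\in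 G}\sum_{k=1}^{N-1}\frac{|\phi_k(z)|^2}{\lambda_k}\right)^{-1}.$$ *)

(* Defs.v *)
From HB Require Import structures.
From mathcomp Require Import all_boot all_order all_algebra.
From mathcomp Require Import all_classical all_reals all_analysis.

Set Implicit Arguments.
Unset Strict Implicit.
Unset Printing Implicit Defensive.

Import Order.TTheory GRing.Theory Num.Theory.

Local Open Scope classical_set_scope.
Local Open Scope ring_scope.

(* Weights on the diagonal are unconstrained; they play no role, since [adj]
   requires distinct vertices. *)
Record wgraph (R : realType) (V : finType) := WGraph {
  weight : V -> V -> R;
  weight_sym : forall x y, weight x y = weight y x;
  weight_ge0 : forall x y, 0 <= weight x y
}.

Definition adj (R : realType) (V : finType) (G : wgraph R V) : rel V :=
  fun x y => (x != y) && (0 < weight G x y).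

Definition connected_graph (R : realType) (V : finType) (G : wgraph R V) : Prop :=
  forall x y : V, connect (adj G) x y.

Definition laplacian (R : realType) (V : finType) (G : wgraph R V)
    (f : V -> R) : V -> R :=
  fun x => \sum_(z | adj G x z) weight G x z * (f x - f z).

Definition inner (R : realType) (V : finType) (u v : V -> R) : R :=
  \sum_x u x * v x.

Definition sqnorm (R : realType) (V : finType) (u : V -> R) : R := inner u u.

(* Since there are #|V| orthonormal eigenvectors, they form a basis of R^V, so
   [lam] lists the eigenvalues with multiplicity; that the smallest one is 0
   follows from [eigenbasis0]. *)
Record laplacian_eigenbasis (R : realType) (V : finType) (G : wgraph R V)
    (lam : 'I_#|V| -> R) (phi : 'I_#|V| -> V -> R) : Prop := {
  eigenbasis_orthonormal : forall i j, inner (phi i) (phi j) = (i == j)%:R;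
  eigenbasis_eigen : forall k x, laplacian G (phi k) x = lam k * phi k x;
  eigenbasis_sorted : forall i j : 'I_#|V|, (i <= j)%N -> lam i <= lam j;
  eigenbasis0 : forall (k : 'I_#|V|) x,
    k = 0%N :> nat -> phi k x = 1 / Num.sqrt #|V|%:R
}.

Definition wavelet (R : realType) (V : finType)
    (lam : 'I_#|V| -> R) (phi : 'I_#|V| -> V -> R) (t : R) (x : V) : V -> R :=
  fun y => \sum_(k < #|V| | (0 < k)%N)
    t * lam k * expR (- (t * lam k)) * phi k x * phi k y.

(* Valued in the extended reals, so that no convergence is presupposed. *)
Definition MDT (R : realType) (V : finType)
    (lam : 'I_#|V| -> R) (phi : 'I_#|V| -> V -> R) (x : V) : \bar R :=
  (\int[@lebesgue_measure R]_(t in `]0%R, +oo[)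
     (sqnorm (wavelet lam phi t x))%:E)%E.

Definition IC (R : realType) (V : finType)
    (lam : 'I_#|V| -> R) (phi : 'I_#|V| -> V -> R) (x : V) : R :=
  (\sum_(k < #|V| | (0 < k)%N) `|phi k x| ^+ 2 / lam k
   + 1 / #|V|%:R *
     \sum_z \sum_(k < #|V| | (0 < k)%N) `|phi k z| ^+ 2 / lam k)^-1.

Definition argmin (d : Order.disp_t) (T : porderType d) (V : Type)
    (f : V -> T) : set V :=
  [set x | forall y, (f x <= f y)%O].

Definition argmax (d : Order.disp_t) (T : porderType d) (V : Type)
    (f : V -> T) : set V :=
  [set x | forall y, (f y <= f x)%O].

(* Main.v *)
Require Import Defs.
From mathcomp Require Import all_boot all_order all_algebra.
From mathcomp Require Import all_classical all_reals all_analysis.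
From mathcomp Require Import measurable_realfun ring.

(** Both quantities are functions of the single number
    S(x) = sum over k > 0 of phi_k(x)^2 / lam_k.

    By orthonormality of the phi_k, the squared norm of the wavelet at scale t
    is the sum over k > 0 of (t lam_k e^{-t lam_k} phi_k(x))^2
    ([sqnorm_wavelet]).  Integrating termwise in t, each frequency contributes
    lam_k^2 phi_k(x)^2 * 2 / (2 lam_k)^3 ([integral_sqrM_expRN]), so that
    MDT(x) = S(x) / 4 ([MDT_eq]): the mean diffusion time is increasing in S.
    On the other hand IC(x) = 1 / (S(x) + c), where c is the average of S over
    the vertices, so the information centrality is decreasing in S as soon as
    these denominators are positive.  Hence minimizing MDT, minimizing S and
    maximizing IC are the same thing.

    Connectedness enters through lam_k > 0 for k > 0 ([eigenvalue_gt0]), which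
    makes the integrals converge and S nonnegative.  The hypothesis of two
    vertices gives at least one such k; then the sum of S over the vertices,
    which is the sum of the 1 / lam_k, is positive, hence so is c. *)

Import Order.TTheory GRing.Theory Num.Theory numFieldNormedType.Exports.
Local Open Scope classical_set_scope.
Local Open Scope ring_scope.

(** Symmetry of the weights lets the roles of the two ends of an edge be
    exchanged in the left-hand side; averaging the two expressions completes
    the square. *)
Lemma dirichlet_energy (R : realType) (V : finType) (G : wgraph R V)
    (f : V -> R) :
  inner f (laplacian G f) *+ 2 =
  \sum_x \sum_(z | adj G x z) weight G x z * (f x - f z) ^+ 2.
Proof.
have swap : inner f (laplacian G f) =
    - \sum_x \sum_(z | adj G x z) weight G x z * f z * (f x - f z).
  rewrite /inner /laplacian -sumrN.
  under eq_bigr do rewrite mulr_sumr.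
  under [RHS]eq_bigr do rewrite -sumrN.
  rewrite (exchange_big_dep predT) //=; apply: eq_bigr => x _.
  apply: eq_big => [z|z _]; first by rewrite /adj eq_sym weight_sym.
  by rewrite weight_sym; ring.
rewrite mulr2n {2}swap -sumrB; apply: eq_bigr => x _.
by rewrite mulr_sumr -sumrB; apply: eq_bigr => z _; ring.
Qed.

(** The Dirichlet energy of [phi k], which counts each edge twice, is
    [2 * lam k].  So [lam k] is nonnegative,
    and if it vanishes then [phi k] takes equal values at adjacent vertices,
    hence is constant by connectedness.  Being orthogonal to the nonzero
    constant eigenvector of index 0, it would be zero, against its norm 1. *)
Lemma eigenvalue_gt0 (R : realType) (V : finType) (G : wgraph R V)
    (lam : 'I_#|V| -> R) (phi : 'I_#|V| -> V -> R) (k : 'I_#|V|) :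
  connected_graph G -> laplacian_eigenbasis G lam phi -> (0 < k)%N ->
  0 < lam k.
Proof.
move=> hG [ortho eig _ phi0E] k_gt0.
have normk : inner (phi k) (phi k) = 1 by rewrite ortho eqxx.
have term_ge0 x z :
    0 <= weight G x z * (phi k x - phi k z) ^+ 2.
  by rewrite mulr_ge0 ?weight_ge0 ?sqr_ge0.
have lamE : lam k *+ 2 =
    \sum_x \sum_(z | adj G x z) weight G x z * (phi k x - phi k z) ^+ 2.
  rewrite -dirichlet_energy -[lam k in LHS]mulr1 -normk mulr_sumr.
  congr (_ *+ 2).
  by apply: eq_bigr => x _; rewrite eig; ring.
have lam_ge0 : 0 <= lam k *+ 2.
  by rewrite lamE; apply: sumr_ge0 => x _; apply: sumr_ge0.
rewrite pmulrn_lge0 // in lam_ge0; rewrite lt_neqAle lam_ge0 andbT.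
apply/eqP => lam0; move/esym: lamE; rewrite -lam0 mul0rn => energy0.
have phi_adj x z : adj G x z -> phi k x = phi k z.
  move=> xz; have inner_ge0 y : true -> 0 <= \sum_(z | adj G y z)
      weight G y z * (phi k y - phi k z) ^+ 2 by move=> _; apply: sumr_ge0.
  have /eqP : \sum_(z | adj G x z) weight G x z * (phi k x - phi k z) ^+ 2 = 0.
    exact: (psumr_eq0P inner_ge0 energy0).
  rewrite psumr_eq0 // => /allP/(_ z); rewrite mem_index_enum xz => /(_ isT).
  have /andP[_ w_gt0] := xz.
  by rewrite mulf_eq0 gt_eqF //= sqrf_eq0 subr_eq0 => /eqP.
have phi_const x y : phi k x = phi k y.
  have /connectP[p] := hG x y.
  elim: p x => [|z p IHp] x /=; first by move=> _ ->.
  by case/andP=> /phi_adj -> /IHp; apply.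
have N_gt0 : (0 < #|V|)%N by exact: leq_trans (ltn_ord k).
have := ortho (Ordinal N_gt0) k; rewrite -val_eqE /= (ltn_eqF k_gt0).
have /card_gt0P[x0 _] := N_gt0.
rewrite /inner; under eq_bigr => x _ do rewrite phi0E // (phi_const x x0).
rewrite sumr_const => /eqP; rewrite mulrn_eq0 (gtn_eqF N_gt0) /=.
rewrite !mulf_eq0 invr_eq0 oner_eq0 sqrtr_eq0 leNgt ltr0n N_gt0 /=.
move=> /eqP c0; move: normk; rewrite /inner big1 => [/eqP|x _].
  by rewrite eq_sym oner_eq0.
by rewrite (phi_const x x0) c0 mul0r.
Qed.

(** One Taylor term of order [n.+1], one more than the power to be beaten,
    bounds the function by [C / x]. *)
Lemma cvgr_expfM_expRN (R : realType) (n : nat) (b : R) : 0 < b ->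
  x ^+ n * expR (- (b * x)) @[x --> +oo] --> (0 : R).
Proof.
move=> b_gt0; pose C : R := n.+1`!%:R / b ^+ n.+1.
apply: (@squeeze_cvgr _ _ _ _ (fun=> 0) (fun x => C * x^-1)).
- near=> x.
  have x_gt0 : 0 < x by near: x; exact: nbhs_pinfty_gt.
  rewrite mulr_ge0 ?exprn_ge0 ?expR_ge0 ?(ltW x_gt0) //=.
  rewrite expRN ler_pdivrMr ?expR_gt0 //.
  have bx_gt0 : 0 < b * x by rewrite mulr_gt0.
  have := @expR_ge1Dxn R (b * x) n (ltW bx_gt0).
  rewrite exprMn => taylor.
  have fact_gt0 : 0 < (n.+1)`!%:R :> R by rewrite ltr0n fact_gt0.
  apply: le_trans (_ : C * x^-1 * (b ^+ n.+1 * x ^+ n.+1 / n.+1`!%:R) <= _).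
    rewrite le_eqVlt; apply/orP; left; apply/eqP; rewrite /C.
    move: (n.+1)`!%:R fact_gt0 => c c_gt0; rewrite [x ^+ n.+1]exprS.
    by field; rewrite !gt_eqF ?exprn_gt0.
  rewrite ler_pM2l; first by rewrite (le_trans _ taylor) // lerDr.
  by rewrite mulr_gt0 ?invr_gt0 // divr_gt0 ?exprn_gt0.
- exact: cvg_cst.
- rewrite -(mulr0 C); apply: cvgMl_tmp.
  by apply/gtr0_cvgV0; [exact: nbhs_pinfty_gt | exact: cvg_id].
Unshelve. all: by end_near. Qed.

Lemma is_derive_expfM_expRN (R : realType) (n : nat) (b t : R) :
  is_derive t 1 (fun t : R => t ^+ n * expR (- (b * t)))
    ((n%:R * t ^+ n.-1 - b * t ^+ n) * expR (- (b * t))).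
Proof.
have dexp : is_derive t 1 (fun t => expR (- (b * t)))
    (- b * expR (- (b * t))).
  apply: is_derive_eq; rewrite /GRing.scale /=; ring.
(* The instances for products and powers are stated for operations on
   functions, so the pointwise expression is first put in that form. *)
rewrite (_ : (fun _ => _) = (id ^+ n : R -> R) * (fun t => expR (- (b * t)))).
  by apply: is_derive_eq; rewrite exprfctE /GRing.scale /=; ring.
by apply/funext => s; rewrite mulrfctE exprfctE.
Qed.

Lemma continuous_expfM_expRN (R : realType) (n : nat) (b : R) :
  continuous (fun t : R => t ^+ n * expR (- (b * t))).
Proof.
move=> t; apply: differentiable_continuous; apply/derivable1_diffP.
by case: (is_derive_expfM_expRN _ n b t).
Qed.

Lemma measurable_expfM_expRN (R : realType) (n : nat) (b : R) (D : set R) :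
  measurable_fun D (fun t : R => t ^+ n * expR (- (b * t))).
Proof.
apply: measurable_funTS; apply: continuous_measurable_fun.
exact: continuous_expfM_expRN.
Qed.

(** This is the value [Gamma 3 / b ^+ 3], obtained from the primitive given by
    two integrations by parts. *)
Lemma integral_sqrM_expRN (R : realType) (b : R) : 0 < b ->
  (\int[@lebesgue_measure R]_(t in `]0%R, +oo[)
     (t ^+ 2 * expR (- (b * t)))%:E = (2 / b ^+ 3)%:E)%E.
Proof.
move=> b_gt0; have b_neq0 : b != 0 by rewrite gt_eqF.
pose f (t : R) := t ^+ 2 * expR (- (b * t)).
pose F (t : R) := - (b^-1 * f t + 2 / b ^+ 2 * (t ^+ 1 * expR (- (b * t)))
                     + 2 / b ^+ 3 * (t ^+ 0 * expR (- (b * t)))).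
have dF (t : R) : is_derive t 1 F (f t).
  rewrite /F; have d2 := is_derive_expfM_expRN _ 2 b t.
  have d1 := is_derive_expfM_expRN _ 1 b t.
  have d0 := is_derive_expfM_expRN _ 0 b t.
  by apply: is_derive_eq; rewrite /f /GRing.scale /=; field.
have cf : continuous f by exact: continuous_expfM_expRN.
have cF : continuous F.
  move=> t; apply: differentiable_continuous; apply/derivable1_diffP.
  by case: (dF t).
rewrite integral_itv_obnd_cbnd; last first.
  by apply/measurable_EFinP; exact: measurable_expfM_expRN.
rewrite (@ge0_continuous_FTC2y _ f F _ 0).
- rewrite /F /f expr0n mulr0 oppr0 expR0 /= -EFinB; congr EFin; ring.
- by move=> x _; rewrite mulr_ge0 ?sqr_ge0 ?expR_ge0.
- exact: continuous_subspaceT.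
- rewrite -oppr0; apply: cvgN.
  rewrite [X in _ --> X](_ : _ =
    b^-1 * 0 + 2 / b ^+ 2 * 0 + 2 / b ^+ 3 * 0); last by ring.
  by apply: cvgD; [apply: cvgD|]; apply: cvgMl_tmp; exact: cvgr_expfM_expRN.
- by move=> x _; case: (dF x).
- exact/cvg_at_right_filter/cF.
- by move=> x _; rewrite derive1E; case: (dF x).
Qed.

(** Parseval's identity for the wavelet.  The powers of [t] are kept apart from
    the coefficients so that each summand is a constant times an integrand of
    [integral_sqrM_expRN], of rate [2 * lam k]. *)
Lemma sqnorm_wavelet (R : realType) (V : finType) (G : wgraph R V)
    (lam : 'I_#|V| -> R) (phi : 'I_#|V| -> V -> R) (t : R) (x : V) :
  laplacian_eigenbasis G lam phi ->
  sqnorm (wavelet lam phi t x) =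
  \sum_(k < #|V| | (0 < k)%N)
    (lam k * phi k x) ^+ 2 * (t ^+ 2 * expR (- (2 * lam k * t))).
Proof.
move=> [ortho _ _ _]; rewrite /sqnorm /inner /wavelet.
under eq_bigr => y _.
  rewrite mulr_suml.
  under eq_bigr => k _ do rewrite mulr_sumr.
  over.
rewrite exchange_big /=; apply: eq_bigr => k k_gt0.
rewrite exchange_big /= (bigD1 k) //= [X in _ + X]big1 => [|j /andP[_ jk]].
  have -> : expR (- (2 * lam k * t)) = expR (- (t * lam k)) ^+ 2.
    by rewrite -expRM_natl; congr expR; ring.
  rewrite addr0.
  transitivity ((t * lam k * expR (- (t * lam k)) * phi k x) ^+ 2 *
    inner (phi k) (phi k)).
    by rewrite /inner mulr_sumr; apply: eq_bigr => y _; ring.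
  by rewrite ortho eqxx mulr1; ring.
transitivity ((t * lam k * expR (- (t * lam k)) * phi k x) *
  (t * lam j * expR (- (t * lam j)) * phi j x) * inner (phi k) (phi j)).
  by rewrite /inner mulr_sumr; apply: eq_bigr => y _; ring.
by rewrite ortho eq_sym (negbTE jk) mulr0.
Qed.

(** The factor 1/4 is [lam k ^+ 2 * (2 / (2 * lam k) ^+ 3)] divided by
    [1 / lam k].  Interchanging integral and sum is free, since all summands
    are nonnegative. *)
Lemma MDT_eq (R : realType) (V : finType) (G : wgraph R V)
    (lam : 'I_#|V| -> R) (phi : 'I_#|V| -> V -> R) (x : V) :
  connected_graph G -> laplacian_eigenbasis G lam phi ->
  MDT lam phi x =
  (4^-1 * \sum_(k < #|V| | (0 < k)%N) `|phi k x| ^+ 2 / lam k)%:E.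
Proof.
move=> hG hphi; rewrite /MDT.
under eq_integral do rewrite (sqnorm_wavelet _ _ _ _ _ _ _ hphi) -sumEFin.
rewrite -big_filter; under eq_integral do rewrite -big_filter.
rewrite ge0_integral_sum //=; last 2 first.
- move=> k; apply/measurable_EFinP; apply: measurable_funM => //.
  exact: measurable_expfM_expRN.
- move=> k t _; rewrite lee_fin mulr_ge0 ?sqr_ge0//.
  by rewrite mulr_ge0 ?sqr_ge0 ?expR_ge0.
rewrite !big_filter mulr_sumr -sumEFin; apply: eq_bigr => k k_gt0.
have lam_gt0 := eigenvalue_gt0 _ _ _ _ _ k hG hphi k_gt0.
under eq_integral do rewrite EFinM.
rewrite ge0_integralZl_EFin ?sqr_ge0 //=.
- rewrite integral_sqrM_expRN ?mulr_gt0 // -EFinM; congr EFin.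
  by rewrite real_normK ?num_real//; field; rewrite gt_eqF.
- by move=> t _; rewrite lee_fin mulr_ge0 ?sqr_ge0 ?expR_ge0.
- by apply/measurable_EFinP; exact: measurable_expfM_expRN.
Qed.

Theorem theorem2 (R : realType) (V : finType) (G : wgraph R V)
    (lam : 'I_#|V| -> R) (phi : 'I_#|V| -> V -> R)
    (hV : (2 <= #|V|)%N)
    (hG : connected_graph G)
    (hphi : laplacian_eigenbasis G lam phi) :
  argmin (MDT lam phi) = argmax (IC lam phi).
Proof.
have lam_gt0 k := eigenvalue_gt0 _ _ _ _ _ k hG hphi.
pose S x := \sum_(k < #|V| | (0 < k)%N) `|phi k x| ^+ 2 / lam k.
have S_ge0 x : 0 <= S x.
  by apply: sumr_ge0 => k /lam_gt0/ltW lk; rewrite divr_ge0 ?sqr_ge0.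
have trace_gt0 : 0 < \sum_z S z.
  (* Exchanging the sums turns the trace of S into a sum over frequencies,
     where each eigenvector has norm 1. *)
  have normE (k : 'I_#|V|) : (0 < k)%N ->
      \sum_z `|phi k z| ^+ 2 / lam k = (lam k)^-1.
    move=> _; rewrite -mulr_suml -[RHS]mul1r; congr (_ * _).
    transitivity (inner (phi k) (phi k)).
      by apply: eq_bigr => z _; rewrite real_normK ?num_real // expr2.
    by case: hphi => ortho _ _ _; rewrite ortho eqxx.
  rewrite /S exchange_big /= (eq_bigr _ normE).
  (* The index 1, which exists because there are two vertices. *)
  have k_gt0 : (0 < Ordinal hV)%N by [].
  rewrite (bigD1 (Ordinal hV)) //= ltr_pwDl ?invr_gt0 ?lam_gt0 //.
  by apply: sumr_ge0 => k /andP[/lam_gt0/ltW lk _]; rewrite invr_ge0.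
have den_gt0 x : 0 < S x + 1 / #|V|%:R * \sum_z S z.
  by rewrite ltr_wpDl // mulr_gt0 // divr_gt0 // ltr0n (leq_trans _ hV).
apply/seteqP; split => x /= x_opt y; have := x_opt y;
  rewrite !(MDT_eq _ _ _ _ _ _ hG hphi) /IC lee_fin ler_pM2l ?invr_gt0 //
    lef_pV2 ?posrE ?den_gt0 // lerD2r //.
Qed.
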